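(* Let $G$ be a connected bipartite graph. Then $\Gamma_{pr}(G)=2\Gamma(G)$ if and only if $G$ is isomorphic to $K_2$.
   Context: All graphs are finite, simple and undirected. A set $D\subseteq V(G)$ is dominating if every vertex is in $D$ or adjacent to a vertex of $D$; it is minimal if no proper subset is dominating. $\Gamma(G)$ is the maximum cardinality of a minimal dominating set of $G$. A paired dominating set (PDS) is a dominating set $D$ such that $G[D]$ has a perfect matching; a PDS is minimal if no proper subset is a PDS. $\Gamma_{pr}(G)$ is the maximum cardinality of a minimal PDS. *)

(* Defs.v *)
From mathcomp Require Import all_boot.
Set Implicit Arguments.
Unset Strict Implicit.
Unset Printing Implicit Defensive.

Record sgraph := SGraph {
  vertex :> finType;
  adj : rel vertex;
  adj_sym : symmetric adj;
  adj_irrefl : irreflexive adj }.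

Section Defs.
Variable G : sgraph.
Implicit Types (D : {set G}) (M : {set {set G}}).

(* The graph without vertices does not count as connected. *)
Definition connected_graph : Prop :=
  0 < #|G| /\ forall x y : G, connect (@adj G) x y.

Definition bipartite : Prop :=
  exists A : {set G}, forall x y : G, adj x y -> (x \in A) != (y \in A).

Definition dominating D : bool :=
  [forall x, (x \in D) || [exists y in D, adj x y]].

Definition minimal_dominating D : bool := minset dominating D.

Definition upper_domination : nat :=
  \max_(D : {set G} | minimal_dominating D) #|D|.

Definition induced_edges D : {set {set G}} :=
  [set [set p.1; p.2] | p in [set p : G * G | [&& p.1 \in D, p.2 \in D & adj p.1 p.2]]].

(* M is a set of edges of G[D] such that every vertex of D lies in exactly one
   of them. *)
Definition perfect_matching D M : bool :=
  (M \subset induced_edges D) && partition M D.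

Definition paired_dominating D : bool :=
  dominating D && [exists M, perfect_matching D M].

Definition minimal_paired_dominating D : bool := minset paired_dominating D.

(* The value is 0 when G has no paired dominating set, that is, when G has an
   isolated vertex. *)
Definition upper_paired_domination : nat :=
  \max_(D : {set G} | minimal_paired_dominating D) #|D|.

End Defs.

Definition isomorphic (G H : sgraph) : Prop :=
  exists2 f : G -> H, bijective f & forall x y : G, adj (f x) (f y) = adj x y.

Lemma complete_sym n : symmetric (fun x y : 'I_n => x != y).
Proof. by move=> x y; rewrite eq_sym. Qed.

Lemma complete_irrefl n : irreflexive (fun x y : 'I_n => x != y).
Proof. by move=> x; rewrite eqxx. Qed.

Definition complete_graph (n : nat) : sgraph :=
  SGraph (@complete_sym n) (@complete_irrefl n).

(* Main.v *)
Require Import Defs.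
From mathcomp Require Import all_boot.

Set Implicit Arguments.
Unset Strict Implicit.
Unset Printing Implicit Defensive.

(* A graph with a paired dominating set has no isolated vertex, so both sides A
   and B of the bipartition are minimal dominating sets and |V| = |A| + |B| is
   at most twice the upper domination number.  Equality with the upper paired
   domination number thus makes V itself a minimal paired dominating set.  If an
   edge uv were outside a perfect matching of V, replacing the matching edges
   uu' and vv' by uv would give the smaller paired dominating set V - {u', v'}.
   Hence every edge is a matching edge, and connectedness leaves only K_2. *)

Section Graph.
Variable G : sgraph.
Implicit Types (x y u v : G) (D A : {set G}) (M : {set {set G}}).

Lemma dominatingP D :
  reflect (forall x, x \notin D -> exists2 y, y \in D & adj x y) (dominating D).
Proof.
apply: (iffP forallP) => [domD x xD | domD x].
  by have := domD x; rewrite (negPf xD) => /exists_inP.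
by case: (boolP (x \in D)) => //= /domD xy; apply/exists_inP.
Qed.

Lemma perfect_matching_edge D M e x : perfect_matching D M -> e \in M ->
  x \in e -> exists2 y, adj x y & e = [set x; y].
Proof.
move=> /andP[/subsetP sM _] /sM /imsetP[[a b]].
rewrite inE /= => /and3P[_ _ ab] ->; rewrite !inE => /orP[]/eqP->.
  by exists b.
by exists a; rewrite 1?adj_sym // setUC.
Qed.

Lemma matched_vertex D M x : perfect_matching D M -> x \in D ->
  exists2 y, adj x y & [set x; y] \in M.
Proof.
move=> pmM xD; have /andP[_ partM] := pmM.
have covx : x \in cover M by rewrite (cover_partition partM).
have eM := pblock_mem covx; have xe : x \in pblock M x by rewrite mem_pblock.
have [y xy e_eq] := perfect_matching_edge pmM eM xe.
by exists y; rewrite // -e_eq.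
Qed.

(** A vertex of [D] is adjacent to its matching partner, any other vertex to a vertex that dominates
    it. *)
Lemma paired_dominating_nbr D x : paired_dominating D -> exists y, adj x y.
Proof.
case/andP=> /dominatingP domD /existsP[M pmM].
have [xD | /domD[y _ xy]] := boolP (x \in D); last by exists y.
by have [y xy _] := matched_vertex pmM xD; exists y.
Qed.

(** A vertex of [D] missing from a dominating subset [D'] would have a neighbour in [D'], hence in
    [D], against independence. *)
Lemma independent_minimal_dominating D : dominating D ->
  {in D &, forall x y, ~~ adj x y} -> minimal_dominating D.
Proof.
move=> domD indD; apply/minsetP; split=> // D' /dominatingP domD' sD'D.
apply/eqP; rewrite eqEsubset sD'D; apply/subsetP=> x xD.
apply: contraT => /domD'[y yD' xy].
by have := indD x y xD (subsetP sD'D y yD'); rewrite xy.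
Qed.

Lemma card_le_upper_domination A :
  (forall x y, adj x y -> (x \in A) != (y \in A)) ->
  (forall x, exists y, adj x y) -> #|A| <= upper_domination G.
Proof.
move=> bipA nbr; apply: (leq_bigmax_cond (F := fun D : {set G} => #|D|)).
apply: independent_minimal_dominating => [|x y xA yA].
  apply/dominatingP=> x xA; have [y xy] := nbr x; exists y => //.
  by have := bipA x y xy; rewrite (negPf xA); case: (y \in A).
by apply/negP=> /bipA; rewrite xA yA.
Qed.

Lemma bipartite_card_le : bipartite G -> (forall x, exists y, adj x y) ->
  #|G| <= 2 * upper_domination G.
Proof.
move=> [A bipA] nbr; rewrite -(cardsC A) mul2n -addnn.
apply: leq_add; apply: card_le_upper_domination => // x y xy.
by rewrite !inE (inj_eq negb_inj) bipA.
Qed.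

Lemma dominating_card_gt0 D : 0 < #|G| -> dominating D -> 0 < #|D|.
Proof.
move=> /card_gt0P[x _] /dominatingP domD; apply/card_gt0P.
by have [xD | /domD[y yD _]] := boolP (x \in D); [exists x | exists y].
Qed.

Lemma dominatingT : dominating [set: G].
Proof. by apply/dominatingP=> x; rewrite inE. Qed.

Lemma upper_domination_gt0 : 0 < #|G| -> 0 < upper_domination G.
Proof.
move=> G_gt0; have [D minD _] := minset_exists dominatingT.
have D_gt0 := dominating_card_gt0 G_gt0 (minsetp minD).
exact: leq_trans D_gt0 (leq_bigmax_cond (F := fun D : {set G} => #|D|) _ minD).
Qed.

Lemma minimal_pairedT_edge M u v : minimal_paired_dominating [set: G] ->
  perfect_matching [set: G] M -> adj u v -> [set u; v] \in M.
Proof.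
move=> minT pmM uv; apply: contraT => uvM.
have [u' uu' uM] := matched_vertex pmM (in_setT u).
have [v' vv' vM] := matched_vertex pmM (in_setT v).
have /andP[sM partM] := pmM.
(* Since [[set u; v]] is not in [M], [v] is not the partner of [u]; so the two matching edges to be
   replaced are distinct blocks. *)
have vNu : v \notin [set u; u'].
  apply: contra uvM; rewrite !inE => /orP[/eqP vu | /eqP->//].
  by rewrite vu adj_irrefl in uv.
have neq : [set v; v'] != [set u; u'].
  by apply: contraNneq vNu => <-; rewrite !inE eqxx.
(* This set is the whole vertex set without [u'] and [v']. It is written in parallel with [M'], so
   that removing and adding blocks shows [M'] to partition it. *)
pose S := [set u; v] :|: ([set: G] :\: [set u; u'] :\: [set v; v']).
pose M' := [set u; v] |: (M :\ [set u; u'] :\ [set v; v']).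
have partS : partition M' S.
  apply: partitionU1.
  - by apply: partitionD1; [apply: partitionD1 | rewrite !inE neq].
  - by apply/set0Pn; exists u; rewrite !inE eqxx.
  - rewrite disjoint_subset; apply/subsetP=> x.
    by rewrite !inE => /orP[]/eqP->; rewrite eqxx ?andbF.
have pdS : paired_dominating S.
  apply/andP; split.
    apply/dominatingP=> x; rewrite !inE.
    have [-> | xu] := eqVneq x u; first by [].
    have [-> | xv] := eqVneq x v; first by rewrite orbT.
    (* Only [u'] and [v'] can be outside [S]; their former partners [u] and [v] dominate them. *)
    have [-> _ | xu'] := eqVneq x u'.
      by exists u; rewrite 1?adj_sym // !inE eqxx.
    have [-> _ | xv'] := eqVneq x v'.
      by exists v; rewrite 1?adj_sym // !inE eqxx ?orbT.
    by [].
  apply/existsP; exists M'; rewrite /perfect_matching partS andbT; apply/subsetP=> e eM'.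
  have eS : e \subset S by rewrite -(cover_partition partS) (bigcup_max e).
  have [a [b [ab e_eq]]] : exists a b, adj a b /\ e = [set a; b].
    move: eM'; rewrite !inE => /orP[/eqP-> | /and3P[_ _ eM]].
      by exists u, v.
    have /imsetP[[a b]] := subsetP sM e eM.
    by rewrite inE => /and3P[_ _ ab] ->; exists a, b.
  apply/imsetP; exists (a, b) => //; rewrite inE /= ab.
  by rewrite !(subsetP eS) // e_eq !inE eqxx ?orbT.
have ST : S = [set: G] by case/minsetP: minT => _; apply=> //; apply: subsetT.
(* The block [[set u; u']] was removed, so [u'] could only be [u], giving a loop, or [v], against
   [vNu]. *)
have : u' \in S by rewrite ST.
rewrite !inE eqxx orbT andbF orbF => /orP[]/eqP eu'.
  by rewrite eu' adj_irrefl in uu'.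
by rewrite -eu' !inE eqxx orbT in vNu.
Qed.

(** Every edge at [u] or [v] is a block of [M] meeting the block [[set u; v]], hence equal to it. So
    this block is closed under adjacency and, by connectedness, is everything. *)
Lemma minimal_pairedT_two : connected_graph G ->
  minimal_paired_dominating [set: G] ->
  exists u v, adj u v /\ forall x, (x == u) || (x == v).
Proof.
move=> [/card_gt0P[u _] conn] minT.
have /andP[_ /existsP[M pmM]] := minsetp minT.
have [v uv uvM] := matched_vertex pmM (in_setT u).
exists u, v; split=> // x.
have /andP[_ /partition_trivIset trivM] := pmM.
have clos : closed (@adj G) [set u; v].
  apply: intro_closed => [a b|a b ab ae]; first by rewrite !conn.
  have abM := minimal_pairedT_edge minT pmM ab.
  by rewrite -(def_pblock trivM uvM ae) (def_pblock trivM abM) !inE eqxx ?orbT.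
have := closed_connect clos (conn u x).
by rewrite !inE eqxx.
Qed.

Lemma two_vertices_isomorphic u v : adj u v ->
  (forall x, (x == u) || (x == v)) -> isomorphic G (complete_graph 2).
Proof.
move=> uv all_uv.
have neq : v != u by apply/eqP=> vu; rewrite vu adj_irrefl in uv.
exists (fun x => if x == u then ord0 else ord_max : 'I_2).
  exists (fun i : 'I_2 => if i == ord0 then u else v) => [x | i].
    by case/orP: (all_uv x) => /eqP->; rewrite ?eqxx ?(negPf neq).
  by case: i => [[|[|//]] ltm]; rewrite /= ?eqxx ?(negPf neq); apply: val_inj.
move=> x y; case/orP: (all_uv x) => /eqP->; case/orP: (all_uv y) => /eqP->;
  by rewrite /= ?eqxx ?(negPf neq) ?adj_irrefl ?uv // adj_sym uv.
Qed.

Lemma isomorphic_two_vertices : isomorphic G (complete_graph 2) ->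
  #|G| = 2 /\ forall x y, adj x y = (x != y).
Proof.
move=> [f bij_f adj_f]; split; first by rewrite (bij_eq_card bij_f) card_ord.
by move=> x y; rewrite -adj_f /= (inj_eq (bij_inj bij_f)).
Qed.

Section TwoVertices.
Hypotheses (card2 : #|G| = 2) (adjE : forall x y, adj x y = (x != y)).

Lemma upper_domination_two : upper_domination G = 1.
Proof.
apply/eqP; rewrite eqn_leq upper_domination_gt0 ?card2 // andbT.
apply/bigmax_leqP=> D minD.
have /card_gt0P[x xD] : 0 < #|D|.
  by apply: dominating_card_gt0 (minsetp minD); rewrite card2.
(* Any single vertex dominates, so minimality shrinks [D] to [[set x]]. *)
have domx : dominating [set x].
  by apply/dominatingP=> y; rewrite inE => yx; exists x; rewrite ?set11 ?adjE.
by case/minsetP: minD => _ /(_ _ domx) <-; rewrite ?cards1 ?sub1set.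
Qed.

Lemma upper_paired_domination_two : upper_paired_domination G = 2.
Proof.
apply/eqP; rewrite eqn_leq; apply/andP; split.
  by apply/bigmax_leqP=> D _; rewrite -card2 max_card.
have pdT : paired_dominating [set: G].
  rewrite /paired_dominating dominatingT; apply/existsP; exists [set [set: G]].
  have /card_gt0P[x _] : 0 < #|G| by rewrite card2.
  apply/andP; split; last first.
    rewrite /partition /cover big_set1 eqxx trivIset1 inE eq_sym.
    by apply/set0Pn; exists x; rewrite inE.
  have /cards2P[a [b [ab Tab]]] : #|[set: G]| == 2 by rewrite cardsT card2.
  by rewrite sub1set; apply/imsetP; exists (a, b); rewrite ?inE ?adjE.
(* For the lower bound, any minimal paired dominating set will do: it is nonempty, so it contains
   both ends of a matching edge. *)
have [D minD _] := minset_exists pdT.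
apply: leq_trans (leq_bigmax_cond (F := fun D : {set G} => #|D|) _ minD).
have /andP[domD /existsP[M pmM]] := minsetp minD.
have /card_gt0P[x xD] : 0 < #|D|.
  by apply: dominating_card_gt0 domD; rewrite card2.
have [y xy eM] := matched_vertex pmM xD.
have /andP[_ /cover_partition covD] := pmM.
have -> : 2 = #|[set x; y]| by rewrite cards2 -adjE xy.
by rewrite -covD subset_leq_card // (bigcup_max [set x; y]).
Qed.

End TwoVertices.
End Graph.

Theorem theorem9 (G : sgraph) (Gconn : connected_graph G) (Gbip : bipartite G) :
  upper_paired_domination G = 2 * upper_domination G <->
  isomorphic G (complete_graph 2).
Proof.
split=> [eqG | /isomorphic_two_vertices[card2 adjE]]; last first.
  by rewrite upper_domination_two // upper_paired_domination_two.
have [D minD cardD] : exists2 D : {set G},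
    minimal_paired_dominating D & #|D| = 2 * upper_domination G.
  (* Positivity rules out the default value 0 of a maximum over no sets, so the maximum is
     attained. *)
  have Gpr_gt0 : 0 < upper_paired_domination G.
    by rewrite eqG muln_gt0 upper_domination_gt0 //; case: Gconn.
  rewrite -eqG; have [D0 minD0 | noD] := pickP (@minimal_paired_dominating G).
    rewrite /upper_paired_domination (bigmax_eq_arg D0) //.
    by case: arg_maxnP => // D minD _; exists D.
  by rewrite /upper_paired_domination big_pred0 in Gpr_gt0.
(* The existence of [D] excludes isolated vertices, so the bipartition bound gives
   [#|G| <= #|D|]. *)
have DT : D = [set: G].
  apply/eqP; rewrite eqEcard subsetT cardsT cardD bipartite_card_le // => x.
  exact: paired_dominating_nbr (minsetp minD).
rewrite DT in minD.
have [u [v [uv all_uv]]] := minimal_pairedT_two Gconn minD.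
exact: two_vertices_isomorphic uv all_uv.
Qed.
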